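(* Let $\Omega$ be a basis of a category $\mathbf{J}$ and let $\mathbf{C}$ be a dagger category. Assume that a functor $D\colon\mathbf{J}\to\mathbf{C}$ has a limit $l_A\colon L\to D(A)$ satisfying $l_A^\dagger l_A l_B^\dagger l_B=l_B^\dagger l_B l_A^\dagger l_A$ for all $A,B\in\Omega$. If $\mathbf{C}$ admits polar decomposition, then $(D,\Omega)$ has a dagger limit.
   Context: A dagger category is a category $\mathbf{C}$ equipped with an identity-on-objects functor $\dagger\colon\mathbf{C}^{\mathrm{op}}\to\mathbf{C}$ satisfying $f^{\dagger\dagger}=f$. A morphism $f$ is a partial isometry if $f=ff^\dagger f$; an endomorphism $f$ is self-adjoint if $f=f^\dagger$; a bimorphism is a morphism that is both monic and epic. A polar decomposition of $f\colon A\to B$ consists of two factorizations $f=pi=jp$ where $p\colon A\to B$ is a partial isometry and $i\colon A\to A$, $j\colon B\to B$ are self-adjoint bimorphisms. A dagger category admits polar decomposition if every morphism has a polar decomposition. A class $\Omega$ of objects of $\mathbf{J}$ is a basis if for every object $B$ of $\mathbf{J}$ there is a unique $A\in\Omega$ with $\mathbf{J}(A,B)\neq\emptyset$. A dagger limit of $(D,\Omega)$ is a limit $(L,l_A\colon L\to D(A))$ of $D$ such that $l_A$ is a partial isometry for all $A\in\Omega$ and $l_A^\dagger l_A l_B^\dagger l_B=l_B^\dagger l_B l_A^\dagger l_A$ for all $A,B\in\Omega$. *)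

(* Defs.v *)
Set Implicit Arguments.
Unset Strict Implicit.
Unset Printing Implicit Defensive.

Declare Scope cat_scope.
Delimit Scope cat_scope with cat.

Record category : Type := Category {
  obj :> Type;
  hom : obj -> obj -> Type;
  idm : forall A : obj, hom A A;
  comp : forall A B C : obj, hom B C -> hom A B -> hom A C;
  comp_idl : forall (A B : obj) (f : hom A B), comp (idm B) f = f;
  comp_idr : forall (A B : obj) (f : hom A B), comp f (idm A) = f;
  comp_assoc : forall (A B C D : obj) (h : hom C D) (g : hom B C) (f : hom A B),
    comp h (comp g f) = comp (comp h g) f
}.

Arguments idm {_} A.

Notation "g ∘ f" := (comp g f) (at level 40, left associativity) : cat_scope.
Local Open Scope cat_scope.

Record functor (J C : category) : Type := Functor {
  fobj :> J -> C;
  fmap : forall A B : J, hom A B -> hom (fobj A) (fobj B);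
  fmap_id : forall A : J, fmap (idm A) = idm (fobj A);
  fmap_comp : forall (A B E : J) (g : hom B E) (f : hom A B),
    fmap (g ∘ f) = fmap g ∘ fmap f
}.

Arguments fmap {J C} D {A B} f : rename.

Definition monic (C : category) (A B : C) (f : hom A B) : Prop :=
  forall (X : C) (g h : hom X A), f ∘ g = f ∘ h -> g = h.

Definition epic (C : category) (A B : C) (f : hom A B) : Prop :=
  forall (X : C) (g h : hom B X), g ∘ f = h ∘ f -> g = h.

Definition bimorphism (C : category) (A B : C) (f : hom A B) : Prop :=
  monic f /\ epic f.

(* The identity-on-objects involutive contravariant functor, given by its
   action on morphisms. *)
Record dagger_category : Type := DaggerCategory {
  dcat :> category;
  dag : forall A B : dcat, hom A B -> hom B A;
  dag_id : forall A : dcat, dag (idm A) = idm A;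
  dag_comp : forall (A B E : dcat) (g : hom B E) (f : hom A B),
    dag (g ∘ f) = dag f ∘ dag g;
  dag_dag : forall (A B : dcat) (f : hom A B), dag (dag f) = f
}.

Notation "f ^†" := (dag f) (at level 1, left associativity, format "f ^†")
  : cat_scope.

Definition partial_isometry (C : dagger_category) (A B : C) (f : hom A B) : Prop :=
  f = f ∘ f^† ∘ f.

Definition self_adjoint (C : dagger_category) (A : C) (f : hom A A) : Prop :=
  f = f^†.

Definition polar_decomposition (C : dagger_category) (A B : C)
    (f p : hom A B) (i : hom A A) (j : hom B B) : Prop :=
  partial_isometry p /\
  (self_adjoint i /\ bimorphism i) /\
  (self_adjoint j /\ bimorphism j) /\
  f = p ∘ i /\ f = j ∘ p.

Definition admits_polar_decomposition (C : dagger_category) : Prop :=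
  forall (A B : C) (f : hom A B),
    exists (p : hom A B) (i : hom A A) (j : hom B B), polar_decomposition f p i j.

Definition basis (J : category) (Omega : J -> Prop) : Prop :=
  forall B : J, exists! A : J, Omega A /\ inhabited (hom A B).

Definition is_cone (J C : category) (D : functor J C) (L : C)
    (l : forall A : J, hom L (D A)) : Prop :=
  forall (A B : J) (f : hom A B), fmap D f ∘ l A = l B.

Definition is_limit (J C : category) (D : functor J C) (L : C)
    (l : forall A : J, hom L (D A)) : Prop :=
  is_cone l /\
  forall (X : C) (x : forall A : J, hom X (D A)), is_cone x ->
    exists! m : hom X L, forall A : J, l A ∘ m = x A.

Definition commuting_on (J : category) (C : dagger_category) (D : functor J C)
    (Omega : J -> Prop) (L : C) (l : forall A : J, hom L (D A)) : Prop :=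
  forall A B : J, Omega A -> Omega B ->
    (l A)^† ∘ l A ∘ (l B)^† ∘ l B = (l B)^† ∘ l B ∘ (l A)^† ∘ l A.

Definition is_dagger_limit (J : category) (C : dagger_category) (D : functor J C)
    (Omega : J -> Prop) (L : C) (l : forall A : J, hom L (D A)) : Prop :=
  is_limit l /\
  (forall A : J, Omega A -> partial_isometry (l A)) /\
  commuting_on Omega l.

(* Main.v *)
Require Import Defs.
From Stdlib Require Import IndefiniteDescription.

(** Decompose every [l A] as [p A ∘ i A = j A ∘ p A]. The partial isometries
    [p A], for [A] in the basis, are the legs of a dagger limit on the same
    apex [L].

    They extend to a cone: a family indexed by the basis does so as soon as
    parallel maps out of a basis object do not distinguish its members
    ([basis_family_extends]), and the epimorphism [i A] can be cancelled from
    [D f ∘ l A = D g ∘ l A].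

    This cone is a limit. Two mediating maps into it are equal because
    composing with [j A] turns [p A] into [l A]. Existence amounts to one
    endomorphism [k] of [L] with [p A ∘ k = l A] for all [A] at once. Such a
    [k] has to satisfy [l A ∘ k = j A ∘ p A ∘ k = j A ∘ l A = l A ∘ i A]; the
    right-hand sides again form a cone, so the universal property of [l]
    produces [k], and cancelling the monomorphism [j A] gives the desired
    equation.

    Finally, [(p A)^† ∘ p A] is the support projection of [(l A)^† ∘ l A],
    and a self-adjoint map commuting with the latter commutes with the former
    ([support_commutes]). Applied once on each side, this carries the
    commutation hypothesis over from [l] to [p]. *)

Set Implicit Arguments.
Unset Strict Implicit.
Local Open Scope cat_scope.

(** * Support projections *)

Lemma partial_isometry_dag (C : dagger_category) (A B : C) (p : hom A B) :
  partial_isometry p -> p^† ∘ p ∘ p^† = p^†.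
Proof.
  unfold partial_isometry; intros Hp.
  rewrite Hp at 4.
  now rewrite !dag_comp, dag_dag, comp_assoc.
Qed.

Lemma gram_self_adjoint (C : dagger_category) (A B : C) (f : hom A B) :
  self_adjoint (f^† ∘ f).
Proof. unfold self_adjoint; now rewrite dag_comp, dag_dag. Qed.

(** Writing [T] for [f^† ∘ f] and [P] for [p^† ∘ p], both [T = P ∘ i ∘ i] and
    [P ∘ T = T] hold. Hence [X ∘ T = T ∘ X = P ∘ T ∘ X = P ∘ X ∘ T], and
    cancelling [i ∘ i] on the right leaves [X ∘ P = P ∘ X ∘ P]. The right-hand
    side is self-adjoint, so [X ∘ P] equals its own dagger [P ∘ X]. *)
Lemma support_commutes (C : dagger_category) (A B : C)
    (f p : hom A B) (i : hom A A) (j : hom B B) (X : hom A A) :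
  polar_decomposition f p i j -> self_adjoint X ->
  f^† ∘ f ∘ X = X ∘ (f^† ∘ f) ->
  p^† ∘ p ∘ X = X ∘ (p^† ∘ p).
Proof.
  intros [Hp [[_ [_ Hie]] [[Hj _] [Hfi Hfj]]]] HX HfX.
  assert (HT : f^† ∘ f = p^† ∘ p ∘ i ∘ i).
  { transitivity ((j ∘ p)^† ∘ (p ∘ i)); [now rewrite <- Hfj, <- Hfi|].
    rewrite dag_comp, <- Hj, comp_assoc, <- (comp_assoc (p^†) j p).
    now rewrite <- Hfj, Hfi, comp_assoc. }
  assert (HPT : p^† ∘ p ∘ (f^† ∘ f) = f^† ∘ f).
  { now rewrite HT, !comp_assoc, (partial_isometry_dag Hp). }
  assert (Hcut : X ∘ (p^† ∘ p) = p^† ∘ p ∘ X ∘ (p^† ∘ p)).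
  { apply Hie, Hie.
    transitivity (X ∘ (f^† ∘ f)); [now rewrite HT, !comp_assoc|].
    transitivity (p^† ∘ p ∘ X ∘ (f^† ∘ f)); [|now rewrite HT, !comp_assoc].
    rewrite <- (comp_assoc (p^† ∘ p) X), <- HfX.
    now rewrite (comp_assoc (p^† ∘ p)), HPT. }
  assert (HP := gram_self_adjoint p); unfold self_adjoint in HP, HX.
  transitivity ((X ∘ (p^† ∘ p))^†).
  - now rewrite dag_comp, <- HP, <- HX.
  - rewrite Hcut at 1.
    rewrite !(dag_comp _ (p^† ∘ p)), (dag_comp (p^† ∘ p)), <- HP, <- HX.
    now rewrite comp_assoc, <- Hcut.
Qed.

Lemma supports_commute (C : dagger_category) (A B B' : C)
    (f p : hom A B) (i : hom A A) (j : hom B B)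
    (f' p' : hom A B') (i' : hom A A) (j' : hom B' B') :
  polar_decomposition f p i j -> polar_decomposition f' p' i' j' ->
  f^† ∘ f ∘ f'^† ∘ f' = f'^† ∘ f' ∘ f^† ∘ f ->
  p^† ∘ p ∘ p'^† ∘ p' = p'^† ∘ p' ∘ p^† ∘ p.
Proof.
  intros Hf Hf' Hff'; rewrite <- !(comp_assoc (_ ∘ _)) in *.
  symmetry; apply (support_commutes Hf'); [apply gram_self_adjoint|].
  symmetry; apply (support_commutes Hf); [apply gram_self_adjoint|].
  exact Hff'.
Qed.

(** * Cones determined on a basis *)

Lemma dependent_choice (I : Type) (T : I -> Type) (R : forall a, T a -> Prop) :
  (forall a, exists t, R a t) -> exists F : forall a, T a, forall a, R a (F a).
Proof.
  intros H.
  exists (fun a => proj1_sig (constructive_indefinite_description _ (H a))).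
  intros a; exact (proj2_sig (constructive_indefinite_description _ (H a))).
Qed.

Section BasisCones.

Variables (J C : category) (Omega : J -> Prop) (D : functor J C).
Hypothesis Omega_basis : basis Omega.

(** The leg at [B] is forced to be [fmap D f ∘ x A] for the basis object [A]
    that maps to [B]. The existence of [A] and [f] makes it exist; the
    uniqueness of [A] and the hypothesis on [x] make it independent of [f]. *)
Lemma basis_family_extends (X : C) (x : forall A : J, hom X (D A)) :
  (forall (A B : J) (f g : hom A B), Omega A ->
     fmap D f ∘ x A = fmap D g ∘ x A) ->
  exists y : forall A : J, hom X (D A),
    is_cone y /\ forall A : J, Omega A -> y A = x A.
Proof.
  intros Hx.
  destruct (@dependent_choice J (fun B => hom X (D B))
    (fun B y => forall (A : J) (f : hom A B), Omega A -> y = fmap D f ∘ x A))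
    as [y Hy].
  { intros B; destruct (Omega_basis B) as [A [[HA [f]] HAu]].
    exists (fmap D f ∘ x A); intros A' f' HA'.
    assert (HAA : A = A') by (apply HAu; split; [|constructor]; assumption).
    subst A'; now apply Hx. }
  exists y; split.
  - intros B E h.
    destruct (Omega_basis B) as [A [[HA [f]] _]].
    rewrite (Hy B A f HA), (Hy E A (h ∘ f) HA).
    now rewrite fmap_comp, comp_assoc.
  - intros A HA.
    now rewrite (Hy A A (idm A) HA), fmap_id, comp_idl.
Qed.

Lemma cones_agree_on_basis (X : C) (x y : forall A : J, hom X (D A)) :
  is_cone x -> is_cone y -> (forall A : J, Omega A -> x A = y A) ->
  forall B : J, x B = y B.
Proof.
  intros Hx Hy Hxy B.
  destruct (Omega_basis B) as [A [[HA [f]] _]].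
  now rewrite <- (Hx A B f), <- (Hy A B f), Hxy.
Qed.

Lemma cone_precompose (X Y : C) (x : forall A : J, hom X (D A)) (m : hom Y X) :
  is_cone x -> is_cone (fun A => x A ∘ m).
Proof. intros Hx A B f; now rewrite comp_assoc, Hx. Qed.

(** Everything rests on one map [k] with [p A ∘ k = l A] for all [A]: then
    [k ∘ m] factors a cone through [p] whenever [m] factors it through [l].
    The map [k] mediates the legs [j A ∘ l A]; writing them as [l A ∘ i A]
    shows that they are compatible with the diagram. *)
Lemma limit_factor (L : C) (l p : forall A : J, hom L (D A))
    (i : forall A : J, hom L L) (j : forall A : J, hom (D A) (D A)) :
  is_limit l -> is_cone p ->
  (forall A : J, Omega A -> monic (j A)) ->
  (forall A : J, Omega A -> l A = j A ∘ p A) ->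
  (forall A : J, Omega A -> j A ∘ l A = l A ∘ i A) ->
  is_limit p.
Proof.
  intros [Hl Hlim] Hp Hj Hlp Hjl; split; [exact Hp|].
  destruct (@basis_family_extends L (fun A => l A ∘ i A)) as [y [Hy HyO]].
  { intros A B f g _; now rewrite !comp_assoc, !Hl. }
  destruct (Hlim L y Hy) as [k [Hk _]].
  assert (Hpk : forall A : J, p A ∘ k = l A).
  { apply cones_agree_on_basis; [now apply cone_precompose|exact Hl|].
    intros A HA; apply (Hj A HA).
    now rewrite comp_assoc, <- Hlp, Hk, HyO, Hjl. }
  intros X x Hx; destruct (Hlim X x Hx) as [m [Hm _]].
  exists (k ∘ m); split.
  - intros A; now rewrite comp_assoc, Hpk.
  - intros m' Hm'.
    destruct (Hlim X (fun A => l A ∘ m')) as [u [_ Hu]];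
      [now apply cone_precompose|].
    transitivity u; [symmetry|]; apply Hu; [|reflexivity].
    apply cones_agree_on_basis; [now apply cone_precompose..|].
    intros A HA.
    rewrite (Hlp A HA), <- !(comp_assoc (j A)), Hm', (comp_assoc (p A)).
    now rewrite Hpk, Hm.
Qed.

End BasisCones.

(** * The dagger limit *)

Theorem theorem8p7 (J : category) (Omega : J -> Prop) (C : dagger_category)
    (D : functor J C) (L : C) (l : forall A : J, hom L (D A)) :
  basis Omega ->
  is_limit l ->
  commuting_on Omega l ->
  admits_polar_decomposition C ->
  exists (L' : C) (l' : forall A : J, hom L' (D A)), is_dagger_limit Omega l'.
Proof.
  intros HO Hl Hcomm Hpolar.
  destruct (dependent_choice (fun A => Hpolar L (D A) (l A))) as [p Hp].
  destruct (dependent_choice Hp) as [i Hi].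
  destruct (dependent_choice Hi) as [j Hpij].
  destruct (@basis_family_extends J C Omega D HO L p) as [q [Hq Hqp]].
  { intros A B f g _.
    destruct (Hpij A) as [_ [[_ [_ Hie]] [_ [Hli _]]]].
    apply Hie; rewrite <- !comp_assoc, <- Hli.
    now rewrite !(proj1 Hl). }
  exists L, q; split; [|split].
  - apply (limit_factor HO (l := l) (i := i) (j := j)); [exact Hl|exact Hq|..];
      intros A HA; destruct (Hpij A) as [_ [_ [[_ [Hjm _]] [Hli Hlj]]]].
    + exact Hjm.
    + now rewrite (Hqp A HA).
    + rewrite Hlj at 2; rewrite Hli at 1; now rewrite comp_assoc.
  - intros A HA; rewrite (Hqp A HA); exact (proj1 (Hpij A)).
  - intros A B HA HB; rewrite (Hqp A HA), (Hqp B HB).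
    exact (supports_commute (Hpij A) (Hpij B) (Hcomm A B HA HB)).
Qed.
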